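(* For a positive integer $n$, a unit weighing matrix $UW(n,2)$ exists if and only if $n$ is even. Moreover, for each even positive integer $n$ there is exactly one equivalence class of $UW(n,2)$.
   Context: $\mathbb{T}$ is the set of complex numbers of absolute value one. A unit weighing matrix $UW(n,p)$ is an $n\times n$ matrix $W$ with entries in $\mathbb{T}\cup\{0\}$ such that $WW^*=pI_n$, where $^*$ is the Hermitian transpose. Two unit weighing matrices are equivalent if one can be obtained from the other by a finite sequence of the operations: permuting rows, permuting columns, multiplying a row by an element of $\mathbb{T}$, multiplying a column by an element of $\mathbb{T}$. *)

(* Defs.v *)
From Stdlib Require Import Relation_Operators.
From mathcomp Require Import all_boot all_order all_algebra all_fingroup.
From mathcomp Require Import complex classical_sets reals.

Set Implicit Arguments.
Unset Strict Implicit.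
Unset Printing Implicit Defensive.

Import Order.TTheory GRing.Theory Num.Theory.

Local Open Scope classical_set_scope.
Local Open Scope sesquilinear_scope.
Local Open Scope ring_scope.

Definition unit_weighing (C : numClosedFieldType) (n p : nat) (W : 'M[C]_n) :
    Prop :=
  (forall i j, `|W i j| = 1 \/ W i j = 0) /\ W *m W ^t* = p%:R%:M.

Definition scale_row (C : numClosedFieldType) (n : nat) (k : 'I_n) (c : C)
    (W : 'M[C]_n) : 'M[C]_n :=
  \matrix_(i, j) (if i == k then c * W i j else W i j).

Definition scale_col (C : numClosedFieldType) (n : nat) (k : 'I_n) (c : C)
    (W : 'M[C]_n) : 'M[C]_n :=
  \matrix_(i, j) (if j == k then c * W i j else W i j).

Inductive uw_step (C : numClosedFieldType) (n : nat) (W : 'M[C]_n) :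
    'M[C]_n -> Prop :=
| Step_row_perm (s : 'S_n) : uw_step W (row_perm s W)
| Step_col_perm (s : 'S_n) : uw_step W (col_perm s W)
| Step_scale_row (k : 'I_n) (c : C) : `|c| = 1 -> uw_step W (scale_row k c W)
| Step_scale_col (k : 'I_n) (c : C) : `|c| = 1 -> uw_step W (scale_col k c W).

Definition uw_equiv (C : numClosedFieldType) (n : nat) (W1 W2 : 'M[C]_n) :
    Prop :=
  clos_refl_trans _ (@uw_step C n) W1 W2.

Definition uw_class (C : numClosedFieldType) (n p : nat)
    (K : set 'M[C]_n) : Prop :=
  exists2 W : 'M[C]_n, unit_weighing p W &
    K = [set W' | unit_weighing p W' /\ uw_equiv W W'].

(* Main.v *)
(**
A row of a UW(n,2) has exactly two nonzero entries, and so has a column since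
[W^* W = 2 I] as well. Two rows whose supports meet have the same support,
otherwise their inner product would be a single unimodular number. Hence rows
and columns both split into pairs, [n] is even, and suitable permutations make
[W] block diagonal with 2x2 blocks. Each block is rescaled to have first row and
first column equal to 1, and orthogonality makes its last entry -1.
*)
Require Import Defs.
From mathcomp Require Import all_boot all_order all_algebra all_fingroup.
From mathcomp Require Import complex classical_sets reals.
From mathcomp Require Import zify ring.
From Stdlib Require Import Relation_Operators.

Set Implicit Arguments.
Unset Strict Implicit.
Unset Printing Implicit Defensive.

Import Order.TTheory GRing.Theory Num.Theory.

Local Open Scope sesquilinear_scope.
Local Open Scope ring_scope.

(** * Symmetry of the equivalence; simultaneous scalings and permutations *)

Section Equivalence.
Variables (C : numClosedFieldType) (n : nat).
Implicit Types W V : 'M[C]_n.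

Lemma mul_conj_unimodular (c : C) : `|c| = 1 -> c^* * c = 1.
Proof. by move=> c1; rewrite mulrC -normCK c1 expr1n. Qed.

(** Each operation is undone by one of the same kind, using the inverse permutation or the conjugate
    scalar. *)
Lemma uw_step_sym W V : uw_step W V -> uw_step V W.
Proof.
case=> [s|s|k c c1|k c c1].
- rewrite -{2}[W](row_perm1 W) -(mulVg s) row_permM; exact: Step_row_perm.
- rewrite -{2}[W](col_perm1 W) -(mulVg s) col_permM; exact: Step_col_perm.
- have -> : W = scale_row k c^* (scale_row k c W) :> 'M[C]_n.
    apply/matrixP=> i j; rewrite !mxE; case: eqP => // _.
    by rewrite mulrA mul_conj_unimodular ?mul1r.
  (* The previous rewriting also expanded the [W] inside the source matrix; this collapses it
     again. *)
  have -> : scale_row k c (scale_row k c^* (scale_row k c W)) = scale_row k c W.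
    apply/matrixP=> i j; rewrite !mxE; case: eqP => // _.
    by rewrite [c^* * _]mulrA mul_conj_unimodular ?mul1r.
  by apply: Step_scale_row; rewrite norm_conjC.
- have -> : W = scale_col k c^* (scale_col k c W) :> 'M[C]_n.
    apply/matrixP=> i j; rewrite !mxE; case: eqP => // _.
    by rewrite mulrA mul_conj_unimodular ?mul1r.
  have -> : scale_col k c (scale_col k c^* (scale_col k c W)) = scale_col k c W.
    apply/matrixP=> i j; rewrite !mxE; case: eqP => // _.
    by rewrite [c^* * _]mulrA mul_conj_unimodular ?mul1r.
  by apply: Step_scale_col; rewrite norm_conjC.
Qed.

Lemma uw_equiv_sym W V : uw_equiv W V -> uw_equiv V W.
Proof.
elim=> [A B /uw_step_sym AB|A|A B D _ BA _ DB]; first exact: rt_step.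
  exact: rt_refl.
exact: rt_trans DB BA.
Qed.

(** A single step scales one row only, so the rows are treated one by one along a list of indices;
    [uniq] ensures that no row is scaled twice. *)
Lemma uw_equiv_row_scale W (d : 'I_n -> C) : (forall i, `|d i| = 1) ->
  uw_equiv W (\matrix_(i, j) (d i * W i j)).
Proof.
move=> d1.
suff scale_seq (r : seq 'I_n) : uniq r ->
    uw_equiv W (\matrix_(i, j) (if i \in r then d i * W i j else W i j)).
  have := scale_seq _ (enum_uniq 'I_n); congr uw_equiv.
  by apply/matrixP=> i j; rewrite !mxE mem_enum.
elim: r => [_|k r IHr /= /andP[kr /IHr Wr]].
  rewrite (_ : \matrix_(i, j) _ = W); first exact: rt_refl.
  by apply/matrixP=> i j; rewrite mxE.
apply: rt_trans Wr _; apply: rt_step.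
set V := (X in uw_step X _).
rewrite (_ : \matrix_(i, j) _ = scale_row k (d k) V).
  exact: Step_scale_row.
apply/matrixP=> i j; rewrite !mxE inE.
by case: eqP => [->|] //=; rewrite (negPf kr).
Qed.

Lemma uw_equiv_col_scale W (e : 'I_n -> C) : (forall j, `|e j| = 1) ->
  uw_equiv W (\matrix_(i, j) (e j * W i j)).
Proof.
move=> e1.
suff scale_seq (r : seq 'I_n) : uniq r ->
    uw_equiv W (\matrix_(i, j) (if j \in r then e j * W i j else W i j)).
  have := scale_seq _ (enum_uniq 'I_n); congr uw_equiv.
  by apply/matrixP=> i j; rewrite !mxE mem_enum.
elim: r => [_|k r IHr /= /andP[kr /IHr Wr]].
  rewrite (_ : \matrix_(i, j) _ = W); first exact: rt_refl.
  by apply/matrixP=> i j; rewrite mxE.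
apply: rt_trans Wr _; apply: rt_step.
set V := (X in uw_step X _).
rewrite (_ : \matrix_(i, j) _ = scale_col k (e k) V).
  exact: Step_scale_col.
apply/matrixP=> i j; rewrite !mxE inE.
by case: eqP => [->|] //=; rewrite (negPf kr).
Qed.

Lemma uw_equiv_perm W (s t : 'S_n) :
  uw_equiv W (\matrix_(i, j) W (s i) (t j)).
Proof.
apply: (@rt_trans _ _ _ (row_perm s W)); first exact/rt_step/Step_row_perm.
rewrite (_ : \matrix_(i, j) _ = col_perm t (row_perm s W)).
  exact/rt_step/Step_col_perm.
by apply/matrixP=> i j; rewrite !mxE.
Qed.

End Equivalence.

(** * Supports of rows and columns, and the adjoint *)

Section UnitWeighing.
Variables (C : numClosedFieldType) (n p : nat).
Implicit Types W : 'M[C]_n.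

Lemma unit_weighing_dot W i k : unit_weighing p W ->
  \sum_j W i j * (W k j)^* = p%:R *+ (i == k).
Proof.
case=> _ /matrixP/(_ i k); rewrite !mxE => <-.
by apply: eq_bigr => j _; rewrite !mxE.
Qed.

Lemma unit_weighing_norm W i j : unit_weighing p W -> W i j != 0 ->
  `|W i j| = 1.
Proof. by case=> /(_ i j)[-> //|->]; rewrite eqxx. Qed.

(** Each nonzero entry contributes 1 to the diagonal entry of [W *m W ^t*], and natural numbers
    embed injectively in [C]. *)
Lemma unit_weighing_row_card W i : unit_weighing p W ->
  #|[set j | W i j != 0]| = p.
Proof.
move=> uwW; apply/eqP; rewrite -(eqr_nat C).
have := unit_weighing_dot i i uwW; rewrite eqxx mulr1n => <-.
rewrite -sum1_card natr_sum big_mkcond; apply/eqP/eq_bigr => j _.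
rewrite inE; case: eqP => [->|/eqP Wij]; first by rewrite mul0r.
by rewrite -normCK (unit_weighing_norm uwW) ?expr1n.
Qed.

(** For square matrices the right inverse [p%:R^-1 *: W ^t*] of [W] is also a left inverse. *)
Lemma unit_weighing_adjoint W : (0 < p)%N -> unit_weighing p W ->
  unit_weighing p (W ^t*).
Proof.
move=> p_gt0 [W01 WW]; split=> [i j|].
  by rewrite !mxE norm_conjC; case: (W01 j i) => ->; [left | right; rewrite rmorph0].
have p_neq0 : p%:R != 0 :> C by rewrite pnatr_eq0 -lt0n.
have WV : W *m (p%:R^-1 *: W ^t*) = 1%:M.
  by rewrite -scalemxAr WW scale_scalar_mx mulVf.
have -> : (W ^t*) ^t* = W by apply/matrixP=> i j; rewrite !mxE conjCK.
move/mulmx1C: WV; rewrite -scalemxAl => /(congr1 ( *:%R p%:R)).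
by rewrite scalerA mulfV // scale1r scale_scalar_mx mulr1.
Qed.

Lemma unit_weighing_col_card W j : (0 < p)%N -> unit_weighing p W ->
  #|[set i | W i j != 0]| = p.
Proof.
move=> p_gt0 /(unit_weighing_adjoint p_gt0) /(unit_weighing_row_card j) <-.
by apply: eq_card => i; rewrite !inE !mxE fmorph_eq0.
Qed.

Lemma unit_weighing_perm W (s t : 'S_n) : unit_weighing p W ->
  unit_weighing p (\matrix_(i, j) W (s i) (t j)).
Proof.
move=> uwW; split=> [i j|]; first by rewrite !mxE; case: uwW.
apply/matrixP=> i k; rewrite !mxE -(inj_eq (@perm_inj _ s)).
rewrite -(unit_weighing_dot _ _ uwW) [RHS](reindex_inj (@perm_inj _ t)).
by apply: eq_bigr => j _; rewrite !mxE.
Qed.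

End UnitWeighing.

Lemma unit_weighing2_support (C : numClosedFieldType) n (W : 'M[C]_n) i k j l :
  unit_weighing 2 W -> W i j != 0 -> W k j != 0 -> W i l != 0 -> W k l != 0.
Proof.
move=> uwW Wij Wkj Wil; apply/eqP => Wkl.
have neq_ik : i != k by apply: contraNneq Wil => ->; rewrite Wkl.
have neq_jl : j != l by apply: contraNneq Wkj => ->; rewrite Wkl.
(* If [W k l] vanished, row [i] would be supported on [j] and [l] alone, and its inner product with
   row [k] would be the single nonzero term at [j]. *)
have suppi : [set j; l] = [set x | W i x != 0].
  apply/eqP; rewrite eqEcard cards2 neq_jl (unit_weighing_row_card _ uwW) andbT.
  by apply/fintype.subsetP=> x; rewrite !inE => /orP[]/eqP->.
have := unit_weighing_dot i k uwW; rewrite (negPf neq_ik) (bigD1 j) //=.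
rewrite big1 ?addr0 => [/eqP|x neq_xj].
  by rewrite mulf_eq0 (negPf Wij) fmorph_eq0 (negPf Wkj).
have [->|neq_xl] := eqVneq x l; first by rewrite Wkl rmorph0 mulr0.
have : x \notin [set j; l] by rewrite !inE negb_or neq_xj.
by rewrite suppi inE negbK => /eqP->; rewrite mul0r.
Qed.

(** * Pairing rows and columns of a zero pattern *)

Section PairedIncidence.
Variables (n : nat) (N : rel 'I_n).
Hypothesis row2 : forall i, #|[set j | N i j]| = 2.
Hypothesis col2 : forall j, #|[set i | N i j]| = 2.
Hypothesis supp : forall i k j l, N i j -> N k j -> N i l -> N k l.

Lemma incidence_columns : exists c : 'I_n -> 'I_n * 'I_n, forall i,
  (c i).1 != (c i).2 /\ forall j, N i j = (j == (c i).1) || (j == (c i).2).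
Proof.
have cP (i : 'I_n) : exists c : 'I_n * 'I_n,
    c.1 != c.2 /\ forall j, N i j = (j == c.1) || (j == c.2).
  have /eqP/cards2P[x [y [neq_xy Nxy]]] := row2 i.
  by exists (x, y); split=> // j; have /setP/(_ j) := Nxy; rewrite !inE.
by case: (fin_all_exists cP) => c; exists c.
Qed.

(** [tau] sends a row to the other row with the same support: a column meeting row [i] has two rows,
    and by [supp] they are the same two for every such column. *)
Lemma incidence_partner : exists tau : 'I_n -> 'I_n, forall i,
  tau i != i /\ forall k j, N i j -> N k j = (k == i) || (k == tau i).
Proof.
have tauP (i : 'I_n) : exists t : 'I_n,
    t != i /\ forall k j, N i j -> N k j = (k == i) || (k == t).
  have [c cP] := incidence_columns; have [_ Ni] := cP i; set c1 := (c i).1 in Ni.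
  have Nic1 : N i c1 by rewrite Ni eqxx.
  have /eqP/cards2P[x [y [neq_xy /setP Nxy]]] := col2 c1.
  have NE k j : N i j -> N k j = (k == x) || (k == y).
    move=> Nij; have := Nxy k; rewrite !inE => <-.
    by apply/idP/idP => Nk; [apply: (supp Nij Nk) | apply: (supp Nic1 Nk)].
  have := NE i c1 Nic1; rewrite Nic1 => /esym/orP[]/eqP ixy.
    by exists y; split=> [|k j /NE->]; rewrite ixy // eq_sym.
  by exists x; split=> [|k j /NE->]; rewrite ixy // orbC.
by case: (fin_all_exists tauP) => tau; exists tau.
Qed.

Lemma incidence_block_form : ~~ odd n /\
  exists s t : 'S_n, forall i j : 'I_n, N (s i) (t j) = (i./2 == j./2).
Proof.
have [c cP] := incidence_columns; have [tau tauP] := incidence_partner.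
have Nc1 i : N i (c i).1 by rewrite (cP i).2 eqxx.
have Nc2 i : N i (c i).2 by rewrite (cP i).2 eqxx orbT.
have tau_neq i : tau i != i := (tauP i).1.
have Ntau i j : N (tau i) j = N i j.
  apply/idP/idP => [Nt|Ni]; last by rewrite ((tauP i).2 _ _ Ni) eqxx orbT.
  apply: supp _ (Nc1 i) Nt.
  by rewrite ((tauP i).2 _ _ (Nc1 i)) eqxx orbT.
have tauK : involutive tau.
  move=> i; have : N (tau (tau i)) (c i).1 by rewrite !Ntau.
  by rewrite ((tauP i).2 _ _ (Nc1 i)) (negPf (tau_neq _)) orbF => /eqP.
(* [A] keeps the smaller index of each pair; [tau] exchanges [A] with its complement. *)
pose A := [set i : 'I_n | (i < tau i)%N].
have tauA i : (tau i \in A) = (i \notin A).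
  by rewrite !inE tauK -leqNgt ltn_neqAle val_eqE tau_neq.
have nA : n = #|A|.*2.
  rewrite -[n in LHS]card_ord -(cardsC A) -addnn; congr (_ + _)%N.
  rewrite -(card_imset A (inv_inj tauK)); apply: eq_card => i.
  by rewrite inE -tauA -[in RHS](tauK i) mem_imset //; apply: inv_inj.
split; first by rewrite nA odd_double.
have half_lt (i : 'I_n) : (i./2 < #|A|)%N by have := ltn_ord i; lia.
(* Positions [2h] and [2h+1] both receive the [h]-th element of [A], which represents block [h]. *)
pose a (i : 'I_n) := enum_val (Ordinal (half_lt i)).
have aA i : a i \in A := enum_valP _.
have a_half i j : a i = a j -> i./2 = j./2 by move/enum_val_inj => [].
have half_a (i j : 'I_n) : i./2 = j./2 -> a i = a j.
  by move=> ij; congr enum_val; apply: val_inj.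
have parity_inj (i j : 'I_n) : i./2 = j./2 -> odd i = odd j -> i = j.
  by move=> ij oij; apply: val_inj; rewrite /= -(odd_double_half i) ij oij
     odd_double_half.
(* Two members of [A] that share a column are equal or partners, and partners never both lie in
   [A]. *)
have Na i j l : N (a i) l -> N (a j) l -> i./2 = j./2.
  move=> Ni; rewrite ((tauP _).2 _ _ Ni) => /orP[]/eqP aij; first exact/esym/a_half.
  by have := aA j; rewrite aij tauA aA.
(* Within a block, the even position gets the representative row and the first column of its
   support, the odd position the partner row and the second column. *)
pose sf (i : 'I_n) := if odd i then tau (a i) else a i.
pose tf (j : 'I_n) := if odd j then (c (a j)).2 else (c (a j)).1.
have Nsf i l : N (sf i) l = N (a i) l by rewrite /sf; case: ifP; rewrite ?Ntau.
have Ntf j : N (a j) (tf j) by rewrite /tf; case: ifP.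
have sf_inj : injective sf.
  move=> i j sij; have hij : i./2 = j./2.
    apply: (@Na _ _ (tf i)) => //; by rewrite -Nsf -sij Nsf.
  apply: parity_inj => //; move: sij; rewrite /sf (half_a _ _ hij).
  have := tau_neq (a j).
  by case: odd; case: odd => // /eqP neq // /esym.
have tf_inj : injective tf.
  move=> i j tij; have hij : i./2 = j./2.
    by apply: (@Na _ _ (tf i)) => //; rewrite tij.
  apply: parity_inj => //; move: tij; rewrite /tf (half_a _ _ hij).
  have [/eqP neq _] := cP (a j).
  by case: odd; case: odd => // /esym.
exists (perm sf_inj), (perm tf_inj) => i j; rewrite !permE Nsf.
apply/idP/eqP => [Nij|hij]; first exact: Na Nij (Ntf j).
by rewrite (half_a _ _ hij).
Qed.

End PairedIncidence.

(** * The canonical matrix and the reduction to it *)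

Lemma even_ord_pairs n : ~~ odd n -> exists p q : 'I_n -> 'I_n,
  forall i, p i = i./2.*2 :> nat /\ q i = i./2.*2.+1 :> nat.
Proof.
move=> evn; have lt_q (i : 'I_n) : (i./2.*2.+1 < n)%N by have := ltn_ord i; lia.
have lt_p (i : 'I_n) : (i./2.*2 < n)%N := ltnW (lt_q i).
by exists (fun i => Ordinal (lt_p i)), (fun i => Ordinal (lt_q i)).
Qed.

Lemma sum_ord_pair (V : nmodType) n (i p q : 'I_n) (F : 'I_n -> V) :
    p = i./2.*2 :> nat -> q = i./2.*2.+1 :> nat ->
    (forall j : 'I_n, i./2 != j./2 -> F j = 0) ->
  \sum_j F j = F p + F q.
Proof.
move=> pE qE F0; have neq_qp : q != p by rewrite -val_eqE /= pE qE; lia.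
rewrite (bigD1 p) //= (bigD1 q) //= big1 ?addr0 // => j /andP[jp jq].
by apply: F0; move: jp jq; rewrite -!val_eqE /= pE qE; lia.
Qed.

(* Block diagonal, every 2x2 block being [[1, 1], [1, -1]]. *)
Definition uw2_canonical (C : numClosedFieldType) n : 'M[C]_n :=
  \matrix_(i, j) if i./2 == j./2 then (-1) ^+ (odd i && odd j) else 0.

Lemma uw2_canonicalP (C : numClosedFieldType) n : ~~ odd n ->
  unit_weighing 2 (uw2_canonical C n).
Proof.
move=> evn; split=> [i j|].
  by rewrite mxE; case: ifP => _; [left; rewrite normrX normrN1 expr1n | right].
have [p [q pqP]] := even_ord_pairs evn; have half_p i : (p i)./2 = i./2.
  by rewrite (pqP i).1 doubleK.
have half_q i : (q i)./2 = i./2 by rewrite (pqP i).2 /= uphalf_double.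
apply/matrixP=> i k; rewrite mxE.
rewrite (sum_ord_pair (pqP i).1 (pqP i).2) => [|j /negPf ij].
  rewrite !mxE half_p half_q eqxx (pqP i).1 (pqP i).2 /= odd_double /= !andbF !andbT.
  rewrite [k./2 == _]eq_sym; case: eqP => [hik|hik]; last first.
    by case: eqP => [ik|_]; [case: hik; rewrite ik | rewrite !rmorph0 !mulr0 addr0].
  have -> : (i == k) = (odd i == odd k).
    apply/eqP/eqP => [->//|oik]; apply: val_inj.
    by rewrite /= -(odd_double_half i) oik hik odd_double_half.
  (* Inside a block the inner product is 1 plus a sign that is positive exactly when the parities of
     [i] and [k] agree, hence 2 or 0. *)
  rewrite expr0 rmorph1 mul1r rmorph_sign -signr_addb.
  by case: (odd i); case: (odd k); rewrite //= ?expr0 ?expr1 ?addrN.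
by rewrite !mxE ij mul0r.
Qed.

Lemma uw2_block_equiv (C : numClosedFieldType) n (W : 'M[C]_n) : ~~ odd n ->
    unit_weighing 2 W -> (forall i j : 'I_n, (W i j != 0) = (i./2 == j./2)) ->
  uw_equiv W (uw2_canonical C n).
Proof.
move=> evn uwW NW; have [p [q pqP]] := even_ord_pairs evn.
have half_p i : (p i)./2 = i./2 by rewrite (pqP i).1 doubleK.
have half_q i : (q i)./2 = i./2 by rewrite (pqP i).2 /= uphalf_double.
have W1 (i j : 'I_n) : i./2 = j./2 -> `|W i j| = 1.
  by move=> ij; apply: (unit_weighing_norm uwW); rewrite NW ij.
have p_even (i : 'I_n) : ~~ odd i -> p i = i.
  by move=> oi; apply: val_inj; rewrite /= (pqP i).1 -[RHS]odd_double_half (negPf oi).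
have q_odd (i : 'I_n) : odd i -> q i = i.
  by move=> oi; apply: val_inj; rewrite /= (pqP i).2 -[RHS]odd_double_half oi.
(* Here [p] and [q] give the first and second index of a block. Scaling by [d] turns the first
   column of every block into ones; scaling by [e] then does the same for the first row and leaves
   that column unchanged. *)
pose d i := (W i (p i))^*.
have d1 i : `|d i| = 1 by rewrite norm_conjC W1 ?half_p.
pose e j := (d (p j) * W (p j) j)^*.
have e1 j : `|e j| = 1 by rewrite norm_conjC normrM d1 W1 ?half_p ?mul1r.
apply: rt_trans (uw_equiv_row_scale W d1) _.
apply: rt_trans (uw_equiv_col_scale _ e1) _.
rewrite (_ : \matrix_(i, j) _ = uw2_canonical C n); first exact: rt_refl.
apply/matrixP=> i j; rewrite !mxE; case: ifPn => [/eqP hij|]; last first.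
  by rewrite -NW negbK => /eqP->; rewrite !mulr0.
have pij : p i = p j by apply: val_inj; rewrite /= (pqP i).1 (pqP j).1 hij.
have ppj : p (p j) = p j by apply: val_inj; rewrite /= (pqP (p j)).1 half_p (pqP j).1.
have conjW (k l : 'I_n) : k./2 = l./2 -> (W k l)^* * W k l = 1.
  by move=> kl; rewrite mul_conj_unimodular ?W1.
rewrite /e /d pij ppj rmorphM /= conjCK.
(* Even [i] is the first row of the block and even [j] its first column; if both are odd, the entry
   is the lower right corner and [i = j]. *)
have [oi|oi] := boolP (odd i); last first.
  rewrite expr0 -(p_even i oi) pij.
  rewrite (_ : _ * _ = ((W (p j) (p j))^* * W (p j) (p j)) * ((W (p j) j)^* * W (p j) j)).
    by rewrite !conjW ?half_p // mulr1.
  by ring.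
have [oj|oj] := boolP (odd j); last first.
  rewrite expr0 (p_even j) //.
  rewrite (_ : _ * _ = ((W j j)^* * W j j) * ((W i j)^* * W i j)).
    by rewrite !conjW // mulr1.
  by ring.
have ij : i = j by rewrite -(q_odd i) // -(q_odd j) //; apply: val_inj;
  rewrite /= (pqP i).2 (pqP j).2 hij.
rewrite expr1 ij; have neq_pj : (p j == j) = false.
  by apply/negP=> /eqP/(congr1 (odd \o val)); rewrite /= (pqP j).1 odd_double oj.
(* Orthogonality of the two rows of the block fixes the remaining corner as -1. *)
have := unit_weighing_dot (p j) j uwW; rewrite neq_pj.
rewrite (sum_ord_pair (pqP j).1 (pqP j).2) => [|l hjl]; last first.
  have /eqP-> : W j l == 0 by rewrite -[_ == 0]negbK NW.
  by rewrite rmorph0 mulr0.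
rewrite q_odd // => /eqP; rewrite addr_eq0 => /eqP orth.
rewrite (_ : _ * _ =
  (W (p j) (p j) * (W j (p j))^*) * ((W (p j) j)^* * W j j)); last by ring.
rewrite orth mulNr; congr (- _).
by rewrite mulrACA [W (p j) j * _]mulrC !conjW ?half_p // mulr1.
Qed.

Lemma unit_weighing2_canonical (C : numClosedFieldType) n (W : 'M[C]_n) :
  unit_weighing 2 W -> ~~ odd n /\ uw_equiv W (uw2_canonical C n).
Proof.
move=> uwW.
have [evn [s [t stP]]] := @incidence_block_form n (fun i j => W i j != 0)
  (fun i => unit_weighing_row_card i uwW)
  (fun j => unit_weighing_col_card j (isT : (0 < 2)%N) uwW)
  (fun i k j l => @unit_weighing2_support C n W i k j l uwW).
split=> //; apply: rt_trans (uw_equiv_perm W s t) _.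
apply: uw2_block_equiv => // [|i j]; first exact: unit_weighing_perm.
by rewrite mxE stP.
Qed.

Local Open Scope complex_scope.

Theorem theorem10 (R : realType) (n : nat) (n_gt0 : (0 < n)%N) :
  ((exists W : 'M[R[i]]_n, unit_weighing 2 W) <-> ~~ odd n) /\
  (~~ odd n -> exists! K : set 'M[R[i]]_n, uw_class 2 K).
Proof.
split; first split=> [[W /unit_weighing2_canonical[] //]|evn].
  by exists (uw2_canonical _ n); apply: uw2_canonicalP.
move=> evn; pose Z := uw2_canonical R[i] n; have uwZ := @uw2_canonicalP R[i] n evn.
(* The class of [Z] is the candidate. Any other representative [W] is equivalent to [Z], and
   symmetry gives the second inclusion between the classes. *)
exists [set V | unit_weighing 2 V /\ uw_equiv Z V]%classic; split; first by exists Z.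
move=> _ [W uwW ->]; have [_ WZ] := unit_weighing2_canonical uwW.
apply/seteqP; split=> V [uwV eqV]; split=> //; first exact: rt_trans WZ eqV.
exact: rt_trans (uw_equiv_sym WZ) eqV.
Qed.
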